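(* There exist real numbers $\alpha,\beta$ with $|\alpha|>1$ and $|\beta|>1$ which are multiplicatively independent and for which the inequality $|\alpha^n-\beta^m|\leq 1$ has infinitely many solutions $(n,m)\in\mathbb{N}^2$. In particular, the asymptotic formula $$\#\{(n,m)\in\mathbb{N}^2 : |\alpha^n-\beta^m|\leq x\}\sim\frac{(\log x)^2}{\log|\alpha|\cdot\log|\beta|}\quad\text{as }x\to\infty$$ does not hold for all multiplicatively independent real numbers $\alpha,\beta$ with $|\alpha|>1$ and $|\beta|>1$.
   Context: $\mathbb{N}$ denotes the positive integers. Nonzero numbers $\alpha,\beta$ are multiplicatively independent if $\alpha^a\beta^b=1$ with $a,b\in\mathbb{Z}$ implies $a=b=0$. *)

(* Defs.v *)
From mathcomp Require Import all_boot all_order all_algebra.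
From mathcomp Require Import all_classical all_reals all_analysis.
Set Implicit Arguments.
Unset Strict Implicit.
Unset Printing Implicit Defensive.
Import Order.TTheory GRing.Theory Num.Theory.
Import numFieldNormedType.Exports.
Local Open Scope classical_set_scope.
Local Open Scope ring_scope.

Definition multiplicatively_independent (R : fieldType) (alpha beta : R) : Prop :=
  [/\ alpha != 0, beta != 0 &
      forall a b : int, alpha ^ a * beta ^ b = 1 -> a = 0 /\ b = 0].

Definition close_powers (R : realType) (alpha beta x : R) : set (nat * nat) :=
  [set p | [/\ (0 < p.1)%N, (0 < p.2)%N & `|alpha ^+ p.1 - beta ^+ p.2| <= x]].

(* The number of solutions is taken in [\bar R], so that it is [+oo] when there
   are infinitely many; [f ~ g] means that [f x / g x] tends to 1. *)
Definition log_square_asymptotics (R : realType) (alpha beta : R) : Prop :=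
  (counting (close_powers alpha beta x) /
     (ln x ^+ 2 / (ln `|alpha| * ln `|beta|))%:E)%E @[x --> +oo%R] --> 1%:E.

(* Main.v *)
Require Import Defs.
From mathcomp Require Import all_boot all_order all_algebra.
From mathcomp Require Import all_classical all_reals all_analysis.
From mathcomp Require Import borel_hierarchy.
Import Order.TTheory GRing.Theory Num.Theory.
Import numFieldNormedType.Exports.
Local Open Scope classical_set_scope.
Local Open Scope ring_scope.

(** Take [beta = e] and [alpha = e^t]. For each [N], the set of real [t] such
    that [|e^(t n) - e^m| < 1] for some [n > N] and some integer [m] is open,
    and it contains every rational, so it is dense. By Baire's theorem some
    irrational [t > 1] lies in all these sets: irrationality of [t] is the
    multiplicative independence of [e^t] and [e], and [t > 1] forces [m > 0].
    For such a pair the counting function is identically [+oo] on [x >= 1]. *)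

(** The strict bound makes the set open. Letting [m] run over all of [int] puts rationals of every
    sign in it, so it is dense in the whole line. *)
Definition close_exponents {R : realType} (N : nat) : set R :=
  \bigcup_(n in [set n | (N < n)%N]) \bigcup_(m : int)
    [set t : R | `|expR (t * n%:R) - expR m%:~R| < 1].

Lemma open_close_exponents {R : realType} N : open (@close_exponents R N).
Proof.
apply: bigcup_open => n _; apply: bigcup_open => m _.
apply: (@open_comp _ _ (fun t : R => `|expR (t * n%:R) - expR m%:~R|)
  [set x | x < 1]); last exact: open_lt.
move=> t _; apply: cvg_norm; apply: cvgB; last exact: cvg_cst.
apply: (@continuous_comp _ _ _ (fun t : R => t * n%:R) expR).
  by apply: cvgM; [exact: cvg_id|exact: cvg_cst].
exact: continuous_expR.
Qed.

Lemma dense_close_exponents {R : realType} N : dense (@close_exponents R N).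
Proof.
move=> O O0 oO; have [t [Ot [q _ qt]]] := @dense_rat R O O0 oO.
exists t; split => //; rewrite -{t Ot}qt.
(* For [q = a / d], take [n = d (N + 1)] and [m = a (N + 1)]: then [q n = m] exactly, and the factor
   [N + 1] ensures [n > N]. *)
exists (`|denq q| * N.+1)%N; first by rewrite /= leq_pmull// absz_gt0 denq_neq0.
exists (numq q * N.+1) => //=.
rewrite [X in expR X - _](_ : _ = (numq q * N.+1)%:~R); first by rewrite subrr normr0.
have qE : ratr q * (denq q)%:~R = (numq q)%:~R :> R.
  by rewrite -[RHS]ratr_int numqE rmorphM/= ratr_int.
by rewrite natrM pmulrn absz_denq mulrA qE intrM.
Qed.

Lemma irrational_close_exponents (R : realType) :
  exists t : R, [/\ 1 < t, irrational t & forall N, close_exponents N t].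
Proof.
(* The irrationals are the intersection of the dense open sets [F N], so a single use of Baire's
   theorem yields irrationality as well. *)
have [F odF irrE] := @irrational_Gdelta R.
have /Baire dE : forall N, open (close_exponents N `&` F N : set R^o) /\
    dense (close_exponents N `&` F N : set R^o).
  move=> N; have [oF dF] := odF N; split.
    exact: openI (open_close_exponents N) oF.
  exact: denseI (open_close_exponents N) (dense_close_exponents N) dF.
have [|t [t1 Et]] := dE [set x | 1 < x] _ (@open_gt R 1).
  by exists (1 + 1); rewrite /= ltrDl.
exists t; split => // [|N]; last by have [] := Et N I.
by rewrite irrE => N _; have [] := Et N I.
Qed.

(** A relation between the powers reads [t a + b = 0], and [a != 0] would give [t = - b / a]. *)
Lemma irrational_multiplicatively_independent (R : realType) (t : R) :
  irrational t -> multiplicatively_independent (expR t) (expR 1).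
Proof.
move=> irrt; split; rewrite ?gt_eqF ?expR_gt0// => a b.
rewrite -!powR_intmul ?expR_ge0// -!expRM mul1r -expRD -[RHS]expR0.
move=> /expR_inj tab.
have [a0|a0] := eqVneq a 0.
  by move: tab; rewrite a0 mulr0 add0r => /eqP; rewrite intr_eq0 => /eqP.
exfalso; apply: irrt; exists (- b%:~R / a%:~R) => //.
rewrite rmorphM/= fmorphV rmorphN/= !ratr_int.
apply/(canLR (mulfK _)); first by rewrite intr_eq0.
by apply/eqP; rewrite eq_sym -addr_eq0 tab.
Qed.

Lemma infinite_close_powers_expR (R : realType) (t : R) :
  1 < t -> (forall N, close_exponents N t) ->
  infinite_set (close_powers (expR t) (expR 1) 1).
Proof.
move=> t1 Et /finite_seqP[X XE].
(* With [N] the largest first coordinate in the supposedly finite solution set, [n > N] produces a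
   solution outside it. *)
have [n /= Xn [m _ /= nm]] := Et (\max_(p <- X) p.1)%N.
have n0 : (0 < n)%N by exact: leq_ltn_trans Xn.
(* [e^m > e^(t n) - 1 > 1] since [e^(t n) > 1 + t n > 2] *)
have m0 : 0 < m.
  rewrite -(ltr0z R) -expR_gt1.
  have tn1 : 1 < t * n%:R.
    by rewrite (lt_le_trans t1)// ler_peMr ?ler1n// ltW// (lt_trans ltr01).
  have := expR_ge1Dx (t * n%:R); move: nm; rewrite ltr_distl => /andP[_].
  by move=> h1 h2; rewrite -(ltrD2r 1) (le_lt_trans _ h1)// (le_trans _ h2)// lerD2l ltW.
case: m nm m0 => // m nm m0.
have : close_powers (expR t) (expR 1) 1 (n, m).
  by split => //=; rewrite -!expRM_natr mul1r ltW.
rewrite XE => /= /(@leq_bigmax_seq _ _ xpredT fst) => /(_ isT) /=.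
by rewrite leqNgt Xn.
Qed.

Lemma infinite_not_log_square_asymptotics (R : realType) (alpha beta : R) :
  1 < `|alpha| -> 1 < `|beta| -> infinite_set (close_powers alpha beta 1) ->
  ~ log_square_asymptotics alpha beta.
Proof.
move=> a1 b1 infS asym.
(* For [x > 1] the solution set contains the one for [1], so the quotient is [+oo] over a positive
   real; its limit [+oo] contradicts uniqueness of limits. *)
suff cvgy : (counting (close_powers alpha beta x) /
    (ln x ^+ 2 / (ln `|alpha| * ln `|beta|))%:E)%E @[x --> +oo%R] --> +oo%E.
  suff : 1%:E = +oo%E :> \bar R by [].
  exact: (cvg_unique (@ereal_hausdorff R) asym cvgy).
apply: cvg_near_cst; near=> x.
have x1 : 1 < x by near: x; exact: nbhs_pinfty_gt.
have infSx : infinite_set (close_powers alpha beta x).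
  apply: sub_infinite_set infS => p [p1 p2 p12]; split => //.
  exact: le_trans p12 (ltW x1).
have c0 : 0 < ln x ^+ 2 / (ln `|alpha| * ln `|beta|).
  by rewrite divr_gt0 ?exprn_gt0 ?mulr_gt0 ?ln_gt0.
rewrite /counting asboolF// inver gt_eqF//.
by rewrite gt0_mulye// lte_fin invr_gt0.
Unshelve. all: by end_near. Qed.

Theorem mainTheorem3 (R : realType) :
  (exists alpha beta : R,
     [/\ 1 < `|alpha|, 1 < `|beta|,
         multiplicatively_independent alpha beta &
         infinite_set (close_powers alpha beta 1)]) /\
  ~ (forall alpha beta : R,
       1 < `|alpha| -> 1 < `|beta| ->
       multiplicatively_independent alpha beta ->
       log_square_asymptotics alpha beta).
Proof.
have [alpha [beta [a1 b1 indep inf]]] : exists alpha beta : R,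
    [/\ 1 < `|alpha|, 1 < `|beta|, multiplicatively_independent alpha beta &
        infinite_set (close_powers alpha beta 1)].
  have [t [t1 irrt Et]] := irrational_close_exponents R.
  exists (expR t), (expR 1); split.
  - by rewrite gtr0_norm ?expR_gt0// expR_gt1 (lt_trans ltr01).
  - by rewrite gtr0_norm ?expR_gt0// expR_gt1.
  - exact: irrational_multiplicatively_independent.
  - exact: infinite_close_powers_expR.
split; first by exists alpha, beta.
move=> asym; apply: (infinite_not_log_square_asymptotics _ _ _ a1 b1 inf).
exact: asym.
Qed.
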